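(* Let $n\ge 1$ and let $T$ be any (possibly nonregular) triangulation of $\Delta_{n-1}\times\Delta_2$. Then there is a tropical oriented matroid with parameters $(n,3)$ whose set of vertices is exactly the set of types of the full-dimensional simplices of $T$.
   Context: Write $[d]=\{1,\ldots,d\}$. An $(n,d)$-type is an $n$-tuple $(A_1,\ldots,A_n)$ of nonempty subsets of $[d]$. Comparability graph: given two $(n,d)$-types $A$ and $B$, the comparability graph $CG_{A,B}$ has vertex set $[d]$; for each $1\le i\le n$, and each $j\in A_i$, $k\in B_i$, draw an edge between $j$ and $k$, which is undirected if $j,k\in A_i\cap B_i$ and directed $j\to k$ otherwise (multiple edges are allowed). A directed path from $a$ to $b$ in such a graph with directed and undirected edges is a sequence of vertices $w_0=a,w_1,\ldots,w_k=b$ and edges $e_1,\ldots,e_k$, at least one of which is directed, such that each $e_i$ is either a directed edge from $w_{i-1}$ to $w_i$ or an undirected edge joining them. A directed cycle is a directed path with identical endpoints; the graph is acyclic if it has no directed cycle. Refinement: the refinement of an $(n,d)$-type $A=(A_1,\ldots,A_n)$ with respect to an ordered partition $(P_1,\ldots,P_r)$ of $[d]$ is $B=(A_1\cap P_{m(1)},\ldots,A_n\cap P_{m(n)})$, where $m(i)$ is the largest index for which $A_i\cap P_{m(i)}$ is nonempty. A tropical oriented matroid $M$ with parameters $(n,d)$ is a collection of $(n,d)$-types satisfying: (Boundary) for each $j\in[d]$, the type $(j,j,\ldots,j)$ (every coordinate equal to the singleton $\{j\}$) is in $M$; (Elimination) for any $A,B\in M$ and any position $j\in[n]$ there is $C\in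 M$ with $C_j=A_j\cup B_j$ and $C_k\in\{A_k,B_k,A_k\cup B_k\}$ for all $k\in[n]$; (Comparability) for any $A,B\in M$ the comparability graph $CG_{A,B}$ is acyclic; (Surrounding) if $A\in M$, then every refinement of $A$ is in $M$. For a type $A$, let $G_A$ be the undirected graph with vertex set $[d]$ in which $i$ and $j$ are joined if there is a coordinate $A_k$ with $i,j\in A_k$. A vertex of $M$ is a type $A\in M$ such that $G_A$ is connected. $\Delta_{n-1}$ and $\Delta_{d-1}$ are simplices with vertices labelled $1,\ldots,n$ and $1,\ldots,d$ respectively (here $d=3$); the vertices of $\Delta_{n-1}\times\Delta_{d-1}$ are labelled $(i,j)$ with $1\le i\le n$, $1\le j\le d$. A triangulation of $\Delta_{n-1}\times\Delta_{d-1}$ is a subdivision into simplices that meet face-to-face and all of whose vertices are vertices of $\Delta_{n-1}\times\Delta_{d-1}$; its full-dimensional simplices have dimension $n+d-2$. The type of a face $F$ of a triangulation is $(S_1,\ldots,S_n)$, where $S_i$ is the set of those $j\in[d]$ for which $(i,j)$ is a vertex of $F$. *)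

(* Defs.v *)
From HB Require Import structures.
From mathcomp Require Import classical_sets reals.
(* after classical_sets, so that set0 and setT are those of finset *)
From mathcomp Require Import all_boot all_order all_algebra.

Set Implicit Arguments.
Unset Strict Implicit.
Unset Printing Implicit Defensive.

Import Order.TTheory GRing.Theory Num.Theory.

Local Open Scope nat_scope.

(* [d] is rendered as 'I_d = {0, ..., d-1}, and similarly for [n]. *)

Section Types.
Variables n d : nat.

(* A tuple of arbitrary subsets of [d]; it is an (n,d)-type when it satisfies
   [is_type]. *)
Definition pretype := {ffun 'I_n -> {set 'I_d}}.

Implicit Types (A B C : pretype) (M : {set pretype}).

Definition is_type A : bool := [forall i, A i != set0].

Definition boundary_type (j : 'I_d) : pretype := [ffun=> [set j]].

(* The triple (i, j, k) is the edge that position i contributes to CG_{A,B}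
   for j in A_i and k in B_i.  An undirected edge {j, k} contributed by i occurs
   both as (i, j, k) and as (i, k, j). *)
Definition cg_edge A B (e : 'I_n * 'I_d * 'I_d) : bool :=
  let: (i, j, k) := e in (j \in A i) && (k \in B i).

Definition cg_undirected A B (e : 'I_n * 'I_d * 'I_d) : bool :=
  let: (i, j, k) := e in (j \in A i :&: B i) && (k \in A i :&: B i).

(* The edge e can be traversed from u to v. *)
Definition cg_step A B (u : 'I_d) (e : 'I_n * 'I_d * 'I_d) (v : 'I_d) : bool :=
  let: (i, j, k) := e in
  cg_edge A B e &&
  (((u == j) && (v == k)) || [&& cg_undirected A B e, u == k & v == j]).

(* s = [:: (e_1, w_1); ...; (e_k, w_k)] is a walk from a = w_0 to w_k = b. *)
Fixpoint cg_walk A B (a : 'I_d) (s : seq ('I_n * 'I_d * 'I_d * 'I_d))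
    (b : 'I_d) : bool :=
  if s is (e, w) :: s' then cg_step A B a e w && cg_walk A B w s' b
  else a == b.

Definition cg_directed_path A B (a b : 'I_d) : Prop :=
  exists s, cg_walk A B a s b /\ has (fun x => ~~ cg_undirected A B x.1) s.

Definition cg_acyclic A B : Prop := forall a, ~ cg_directed_path A B a a.

Definition ordered_partition (P : seq {set 'I_d}) : bool :=
  uniq P && partition [set S in P] [set: 'I_d].

(* The largest index of a block meeting S; junk value 0 if there is none, which
   does not happen for S nonempty and P an ordered partition. *)
Definition last_block (P : seq {set 'I_d}) (S : {set 'I_d}) : nat :=
  \max_(m < size P | S :&: nth set0 P m != set0) m.

Definition refinement A (P : seq {set 'I_d}) : pretype :=
  [ffun i => A i :&: nth set0 P (last_block P (A i))].

Record tropical_oriented_matroid M : Prop := TropicalOrientedMatroid {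
  tom_types : forall A, A \in M -> is_type A;
  tom_boundary : forall j, boundary_type j \in M;
  tom_elimination : forall A B (j : 'I_n), A \in M -> B \in M ->
    exists C, [/\ C \in M, C j = A j :|: B j &
      forall k, [\/ C k = A k, C k = B k | C k = A k :|: B k]];
  tom_comparability : forall A B, A \in M -> B \in M -> cg_acyclic A B;
  tom_surrounding : forall A P, A \in M -> ordered_partition P ->
    refinement A P \in M }.

Definition type_graph A : rel 'I_d :=
  fun i j => [exists k, (i \in A k) && (j \in A k)].

Definition type_graph_connected A : bool :=
  [forall i, forall j, connect (type_graph A) i j].

Definition tom_vertices M : {set pretype} :=
  [set A in M | type_graph_connected A].

End Types.

Section Geometry.
Local Open Scope ring_scope.
Variables (R : realType) (V : lmodType R) (I : finType) (p : I -> V).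

Definition conv_hull (S : {set I}) : set V :=
  (fun x => exists w : I -> R,
    [/\ forall i, i \in S -> 0 <= w i, \sum_(i in S) w i = 1 &
        x = \sum_(i in S) w i *: p i]).

Definition affinely_independent (S : {set I}) : Prop :=
  forall w : I -> R, \sum_(i in S) w i = 0 -> \sum_(i in S) w i *: p i = 0 ->
    forall i, i \in S -> w i = 0.

End Geometry.

Section Triangulations.
Local Open Scope classical_set_scope.
Local Open Scope ring_scope.
Variables (R : realType) (n d : nat).

Definition std_simplex (m : nat) : set 'rV[R]_m :=
  (fun x => (forall i, 0 <= x 0 i) /\ \sum_i x 0 i = 1).

(* Delta_{n-1} x Delta_{d-1}, inside R^n x R^d *)
Definition simplex_product : set ('rV[R]_n * 'rV[R]_d) :=
  @std_simplex n `*` @std_simplex d.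

Definition product_vertex (v : 'I_n * 'I_d) : 'rV[R]_n * 'rV[R]_d :=
  (delta_mx 0 v.1, delta_mx 0 v.2).

(* A triangulation is given by the vertex sets of all its nonempty simplices,
   of every dimension. The faces of the simplex with (affinely independent)
   vertex set F are the hulls of the subsets of F, so [tri_meet] says that two
   simplices meet in a possibly empty common face. *)
Record triangulation (T : {set {set 'I_n * 'I_d}}) : Prop := Triangulation {
  tri_nonempty : forall F, F \in T -> F != set0;
  tri_simplex : forall F, F \in T -> affinely_independent product_vertex F;
  tri_face : forall F G : {set 'I_n * 'I_d},
    F \in T -> G != set0 -> G \subset F -> G \in T;
  tri_meet : forall F G, F \in T -> G \in T ->
    exists H : {set 'I_n * 'I_d}, [/\ H \subset F, H \subset G &
      conv_hull product_vertex F `&` conv_hull product_vertex G =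
      conv_hull product_vertex H];
  tri_cover :
    \bigcup_(F in [set` T]) conv_hull product_vertex F = simplex_product }.

End Triangulations.

Section FaceTypes.
Variables n d : nat.

Definition simplex_dim (F : {set 'I_n * 'I_d}) : nat := #|F|.-1.

Definition full_simplices (T : {set {set 'I_n * 'I_d}}) :
    {set {set 'I_n * 'I_d}} :=
  [set F in T | simplex_dim F == n + d - 2]%SET.

Definition face_type (F : {set 'I_n * 'I_d}) : pretype n d :=
  [ffun i => [set j | (i, j) \in F]%SET].

End FaceTypes.

(* Main.v *)
Require Import Defs.
From mathcomp Require Import boolp reals.
From mathcomp Require Import all_boot all_order all_algebra.
From mathcomp Require Import zify lra.

(** The matroid consists of the types of all faces of the triangulation [T] that
    have no empty coordinate. Its vertices are the types of the faces whose
    bipartite graph, with an edge [(i, j)] for each vertex [(i, j)] of the face,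
    is connected. As the vertices of a simplex are independent, this graph is a
    forest, and it is connected precisely when it has as many edges as a
    full-dimensional simplex has vertices (lemma [tri_types_vertices]). Surrounding
    holds because the face of a refinement is contained in the face of the type.

    The geometry enters through two facts. Each nonnegative combination of
    vertices of the product has a unique representation carried by a simplex of
    [T] (lemmas [carried_uniq] and [carried_exists]); and a short segment leaving
    the relative interior of a simplex [A] lies in a simplex containing [A] (lemma
    [star_cover]).

    Uniqueness gives comparability. Adding up the edges of a closed path of
    [CG_{A,B}] at their sources gives weights on [A], and at their targets weights
    on [B], both representing the same point; so the weights coincide and all
    these edges are undirected (lemma [comparable_return]).

    Elimination follows by induction on the number of rows where [A] and [B]
    differ, once there is a row [i] with [A i <> B i] for which [T] has a simplex
    containing both [A] and the vertices [(i, j)] with [j \in B i] (lemma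
    [exchange_row]): either [i] is the prescribed position and the union of rows
    is available at once, or row [i] of [A] can be replaced by that of [B]. To
    find [i], take the simplex [F] of the star of [A] entered when moving from [A]
    towards [B]. In [CG_{F,B}], call an element settled if it reaches no row where
    [A] and [B] differ. The functional counting settled columns minus the rows
    [i] for which [A i] contains a settled element vanishes on [A] and is
    nonpositive on [F], so it cannot be positive at [B]; this prevents [B i] from
    having settled elements when [A i <> B i]. Now take a terminal strong
    component of the unsettled elements. It meets a row [i] of [F] with
    [A i <> B i], all edges of [CG_{F,B}] out of this row end in the component,
    and by comparability they are undirected, that is, [B i] is contained in row
    [i] of [F]. *)

Set Implicit Arguments.
Unset Strict Implicit.
Unset Printing Implicit Defensive.

Import Order.TTheory GRing.Theory Num.Theory.

Local Open Scope ring_scope.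

Section Weights.
Variables (R : realType) (n d : nat).

Local Notation I := ('I_n * 'I_d)%type.
Local Notation pv := (@product_vertex R n d).

Implicit Types (F G : {set I}) (w : I -> R).

(** * Weights on the vertices of the product *)

(** Equality of the points [\sum_v w v *: product_vertex v], expressed by affine
    functionals: this is the form in which it is both verified and used. *)
Definition moment_eq w w' := forall (a : 'I_n -> R) (b : 'I_d -> R),
  \sum_v w v * (a v.1 + b v.2) = \sum_v w' v * (a v.1 + b v.2).

Definition carried F w :=
  (forall v, 0 <= w v) /\ (forall v, v \notin F -> w v = 0).

Definition indic F : I -> R := fun v => (v \in F)%:R.

Lemma carried_indic F : carried F (indic F).
Proof.
by split=> v; rewrite /indic; [exact: ler0n | move/negbTE=> ->].
Qed.

Lemma sum_indic1 v (f : I -> R) : \sum_u indic [set v] u * f u = f v.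
Proof.
rewrite (bigD1 v) //= big1 => [|u /negbTE uv]; rewrite /indic inE.
  by rewrite eqxx mul1r addr0.
by rewrite uv mul0r.
Qed.

Lemma carried_point F v : v \in F -> carried F (indic [set v]).
Proof.
move=> vF; split=> u; first exact: ler0n.
by rewrite /indic inE; case: eqP => // ->; rewrite vF.
Qed.

Lemma carriedD F w w' : carried F w -> carried F w' ->
  carried F (fun v => w v + w' v).
Proof.
move=> [w_ge0 w0] [w'_ge0 w'0]; split=> v; first by rewrite addr_ge0.
by move=> vF; rewrite w0 ?w'0 ?addr0.
Qed.

Lemma carried_scale c F w : 0 <= c -> carried F w ->
  carried F (fun v => c * w v).
Proof.
move=> c0 [w_ge0 w0]; split=> v; first by rewrite mulr_ge0.
by move/w0 ->; rewrite mulr0.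
Qed.

Lemma moment_eq_scale c w w' : moment_eq w w' ->
  moment_eq (fun v => c * w v) (fun v => c * w' v).
Proof.
move=> E a b; under eq_bigr do rewrite -mulrA.
by rewrite -mulr_sumr E mulr_sumr; apply: eq_bigr => v _; rewrite mulrA.
Qed.

Lemma moment_eq_total w w' : moment_eq w w' -> \sum_v w v = \sum_v w' v.
Proof.
move=> /(_ (fun=> 1) (fun=> 0)).
by under eq_bigr do rewrite addr0 mulr1; under [RHS]eq_bigr do rewrite addr0 mulr1.
Qed.

Lemma sum_vertex1 w i :
  (\sum_v w v *: pv v).1 0 i = \sum_v w v * ((v.1 == i)%:R + 0).
Proof.
rewrite (raddf_sum (@fst _ _)) summxE; apply: eq_bigr => v _.
by rewrite /= !mxE eqxx /= addr0 eq_sym.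
Qed.

Lemma sum_vertex2 w j :
  (\sum_v w v *: pv v).2 0 j = \sum_v w v * (0 + (v.2 == j)%:R).
Proof.
rewrite (raddf_sum (@snd _ _)) summxE; apply: eq_bigr => v _.
by rewrite /= !mxE eqxx /= add0r eq_sym.
Qed.

(** Every functional [(a, b)] factors through the point [x], which is what
    makes [moment_eq] equivalent to the equality of points. *)
Lemma sum_affine (x : 'rV[R]_n * 'rV[R]_d) w (a : 'I_n -> R) (b : 'I_d -> R) :
  x = \sum_v w v *: pv v ->
  \sum_v w v * (a v.1 + b v.2) = \sum_i x.1 0 i * a i + \sum_j x.2 0 j * b j.
Proof.
move=> ->; under [X in _ = X + _]eq_bigr do rewrite sum_vertex1 mulr_suml.
under [X in _ = _ + X]eq_bigr do rewrite sum_vertex2 mulr_suml.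
rewrite exchange_big [X in _ = _ + X]exchange_big -big_split /=.
apply: eq_bigr => v _; rewrite mulrDr (bigD1 v.1) //= big1 ?addr0; last first.
  by move=> i /negbTE ni; rewrite eq_sym ni addr0 mulr0 mul0r.
rewrite (bigD1 v.2) //= big1 ?addr0; last first.
  by move=> i /negbTE ni; rewrite eq_sym ni addr0 mulr0 mul0r.
by rewrite !eqxx ?addr0 ?add0r ?mulr1.
Qed.

Lemma moment_eqP w w' :
  moment_eq w w' <-> \sum_v w v *: pv v = \sum_v w' v *: pv v.
Proof.
split=> [E | E a b]; last by rewrite (sum_affine _ _ E) (sum_affine a b erefl).
rewrite [LHS]surjective_pairing [RHS]surjective_pairing; congr pair.
  by apply/rowP => i; rewrite !sum_vertex1; exact: (E (fun k => (k == i)%:R) (fun=> 0)).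
by apply/rowP => j; rewrite !sum_vertex2; exact: (E (fun=> 0) (fun k => (k == j)%:R)).
Qed.

Lemma sum_carried (V : lmodType R) (f : I -> V) F w :
  (forall v, v \notin F -> w v = 0) ->
  \sum_v w v *: f v = \sum_(v in F) w v *: f v.
Proof.
move=> w0; rewrite (bigID (mem F)) /= [X in _ + X]big1 ?addr0 // => v /w0 ->.
by rewrite scale0r.
Qed.

Lemma sum_carried1 F w :
  (forall v, v \notin F -> w v = 0) -> \sum_v w v = \sum_(v in F) w v.
Proof.
by move=> w0; rewrite (bigID (mem F)) /= [X in _ + X]big1 ?addr0.
Qed.

Lemma carried_hull F w : carried F w -> \sum_v w v = 1 ->
  conv_hull pv F (\sum_v w v *: pv v).
Proof.
case=> w_ge0 w0 w1; exists w; split=> [v _||] //.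
  by rewrite -(sum_carried1 w0).
exact: sum_carried.
Qed.

Lemma hull_carried F x : conv_hull pv F x ->
  exists w, [/\ carried F w, \sum_v w v = 1 & x = \sum_v w v *: pv v].
Proof.
case=> w [w_ge0 w1 ->]; pose u v := if v \in F then w v else 0.
have u0 v : v \notin F -> u v = 0 by rewrite /u => /negbTE ->.
exists u; split.
- by split=> // v; rewrite /u; case: ifP => // /w_ge0.
- by rewrite (sum_carried1 u0) -w1; apply: eq_bigr => v; rewrite /u => ->.
- by rewrite (sum_carried _ u0); apply: eq_bigr => v; rewrite /u => ->.
Qed.

Lemma affine_uniq F w w' : affinely_independent pv F ->
  (forall v, v \notin F -> w v = 0) -> (forall v, v \notin F -> w' v = 0) ->
  moment_eq w w' -> w =1 w'.
Proof.
move=> Find w0 w'0 E v; apply/eqP; rewrite -subr_eq0; apply/eqP.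
have d0 u : u \notin F -> w u - w' u = 0 by move=> uF; rewrite w0 ?w'0 ?subrr.
have [vF|/d0//] := boolP (v \in F).
apply: (Find (fun u => w u - w' u)) => //.
  by rewrite -(sum_carried1 d0) sumrB (moment_eq_total E) subrr.
rewrite -(sum_carried _ d0); under eq_bigr do rewrite scalerBl.
by rewrite sumrB (moment_eqP w w').1 // subrr.
Qed.

(** * Types and vertex sets *)

Definition type_face (A : pretype n d) : {set I} := [set v | v.2 \in A v.1].

Lemma in_type_face A v : (v \in type_face A) = (v.2 \in A v.1).
Proof. by rewrite inE. Qed.

Lemma type_faceK : cancel type_face (@face_type n d).
Proof. by move=> A; apply/ffunP => i; rewrite ffunE; apply/setP => j; rewrite !inE. Qed.

Lemma face_typeK : cancel (@face_type n d) type_face.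
Proof. by move=> F; apply/setP => -[i j]; rewrite inE ffunE inE. Qed.

Lemma in_face_type F i j : (j \in face_type F i) = ((i, j) \in F).
Proof. by rewrite ffunE inE. Qed.

(** * Relations on the vertices of a simplex *)

(** [(1, -1)] always vanishes on the product, as both factors have total 1;
    these are the vertex sets of full rank modulo that relation. *)
Definition only_trivial_relation F := forall (a : 'I_n -> R) (b : 'I_d -> R),
  (forall v, v \in F -> a v.1 + b v.2 = 0) ->
  exists c, (forall i, a i = c) /\ (forall j, b j = - c).

Definition vertex_mx F : 'M[R]_(#|F|, n + d) :=
  \matrix_l row_mx (delta_mx 0 (enum_val l).1) (delta_mx 0 (enum_val l).2).

Lemma vertex_mx_mul F (a : 'rV_n) (b : 'rV_d) l :
  (vertex_mx F *m (row_mx a b)^T) l 0 = a 0 (enum_val l).1 + b 0 (enum_val l).2.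
Proof.
rewrite mxE big_split_ord /=; congr (_ + _).
  rewrite (bigD1 (enum_val l).1) //= big1 => [|i /negbTE ni];
    rewrite [vertex_mx F _ _]mxE [_^T _ _]mxE !row_mxEl mxE.
    by rewrite !eqxx mul1r addr0.
  by rewrite ni andbF mul0r.
rewrite (bigD1 (enum_val l).2) //= big1 => [|i /negbTE ni];
  rewrite [vertex_mx F _ _]mxE [_^T _ _]mxE !row_mxEr mxE.
  by rewrite !eqxx mul1r addr0.
by rewrite ni andbF mul0r.
Qed.

(** Affine and linear independence agree, as the product lies in a hyperplane
    that avoids the origin. *)
Lemma vertex_mx_free F : affinely_independent pv F -> row_free (vertex_mx F).
Proof.
move=> Find; apply: inj_row_free => v vN.
pose w x := \sum_(l : 'I_#|F| | enum_val l == x) v 0 l.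
have w0 x : x \notin F -> w x = 0.
  by move=> xF; apply: big1 => l /eqP lx; rewrite -lx enum_valP in xF.
have : w =1 fun=> 0.
  apply: (affine_uniq Find w0) => // a b.
  rewrite [RHS]big1 => [|x _]; last by rewrite mul0r.
  pose u := row_mx (\row_i a i) (\row_j b j).
  transitivity ((v *m vertex_mx F *m u^T) 0 0); last by rewrite vN mul0mx mxE.
  rewrite -mulmxA [RHS]mxE (partition_big (fun l : 'I_#|F| => enum_val l) predT) //=.
  apply: eq_bigr => x _; rewrite mulr_suml; apply: eq_bigr => l /eqP <-.
  by rewrite vertex_mx_mul !mxE.
move=> wE; apply/rowP => l; rewrite [RHS]mxE -(wE (enum_val l)) /w (bigD1 l) //=.
by rewrite big1 ?addr0 // => k /andP[/eqP/enum_val_inj->]; rewrite eqxx.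
Qed.

(** Rank-nullity for the matrix whose rows are the vertices of [F]. *)
Lemma card_only_trivial F : (0 < n)%N -> affinely_independent pv F ->
  (#|F| == (n + d).-1) <-> only_trivial_relation F.
Proof.
move=> n_gt0 /vertex_mx_free/eqP rankF.
(* K consists of the relations; its rank is n + d - #|F|. *)
pose K := kermx (vertex_mx F)^T.
pose u0 : 'rV[R]_(n + d) := row_mx (const_mx 1) (const_mx (-1)).
have kerP (u : 'rV_(n + d)) : (u <= K)%MS <-> vertex_mx F *m u^T = 0.
  split=> [/sub_kermxP E|E]; last apply/sub_kermxP.
    by apply: trmx_inj; rewrite trmx_mul trmxK E trmx0.
  by apply: trmx_inj; rewrite trmx_mul trmxK E trmx0.
have u0K : (u0 <= K)%MS.
  by apply/kerP/matrixP => l k; rewrite ord1 vertex_mx_mul !mxE subrr.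
have u0_neq0 : u0 != 0.
  apply/eqP => /rowP/(_ (lshift d (Ordinal n_gt0)))/eqP.
  by rewrite row_mxEl !mxE oner_eq0.
have rankK : \rank K = (n + d - #|F|)%N by rewrite mxrank_ker mxrank_tr rankF.
have leF : (#|F| <= n + d)%N by rewrite -rankF rank_leq_col.
have rank_u0 : \rank u0 = 1%N by rewrite rank_rV u0_neq0.
split=> [/eqP cF a b ab0 | triv].
  have /eqmxP eqK : (u0 == K)%MS.
    by rewrite -(mxrank_leqif_eq u0K) rank_u0 rankK cF; apply/eqP; lia.
  have : (row_mx (\row_i a i) (\row_j b j) <= u0)%MS.
    rewrite eqK; apply/kerP/matrixP => l k.
    by rewrite ord1 vertex_mx_mul !mxE ab0 ?enum_valP.
  case/sub_rVP=> c /rowP E; exists c; split=> k.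
    by have := E (lshift d k); rewrite row_mxEl [RHS]mxE row_mxEl !mxE mulr1.
  by have := E (rshift n k); rewrite row_mxEr [RHS]mxE row_mxEr !mxE mulrN1.
have Ku0 : (K <= u0)%MS.
  apply/row_subP => k; have := row_sub k K; move: (row k K) => u.
  rewrite -[u]hsubmxK => /kerP uN.
  have [v vF|c [cl cr]] := triv (fun i => lsubmx u 0 i) (fun j => rsubmx u 0 j).
    have /matrixP/(_ (enum_rank_in vF v) 0) := uN.
    by rewrite vertex_mx_mul enum_rankK_in // => ->; rewrite mxE.
  apply/sub_rVP; exists c; rewrite scale_row_mx; congr row_mx; apply/rowP => k'.
    by rewrite cl !mxE mulr1.
  by rewrite cr !mxE mulrN1.
have := mxrankS u0K; have := mxrankS Ku0; rewrite rank_u0 rankK => ? ?.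
by apply/eqP; lia.
Qed.

(** A relation satisfies [b j = - a i] along every edge [(i, j)] of the bipartite
    graph of the face, so its values are free up to one choice per connected
    component; the conditions on the right say that this graph is connected. *)
Lemma only_trivial_spanning (A : pretype n d) : (0 < d)%N ->
  only_trivial_relation (type_face A) <->
  is_type A /\ type_graph_connected A.
Proof.
move=> d_gt0; have adj i j k : j \in A i -> k \in A i -> type_graph A j k.
  by move=> jA kA; apply/existsP; exists i; rewrite jA.
split=> [triv | [tA conA] a b ab0].
  split.
    apply/forallP => i; apply/eqP => Ai0.
    have [v|c [ac bc]] := triv (fun k => (k == i)%:R) (fun=> 0).
      rewrite inE addr0; case: eqP => // ->.
      by rewrite Ai0 inE.
    have /eqP := ac i; rewrite eqxx -[c]opprK -(bc (Ordinal d_gt0)) oppr0.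
    by rewrite oner_eq0.
  apply/forallP => j; apply/forallP => k.
  (* The relation b = 1 on the component S of j, a = -1 on the rows meeting S. *)
  pose S := [set l | connect (type_graph A) j l].
  have [[i l]|c [ac bc]] :=
      triv (fun i => - (A i :&: S != set0)%:R) (fun l => (l \in S)%:R).
    rewrite inE /= => lA; have [lS|lS] := boolP (l \in S).
      suff -> : A i :&: S != set0 by rewrite addNr.
      by apply/set0Pn; exists l; rewrite inE lA.
    have [_|/set0Pn[m /setIP[mA mS]]] := eqVneq (A i :&: S) set0.
      by rewrite oppr0 addr0.
    case/negP: lS; rewrite !inE in mS *.
    by apply: connect_trans mS (connect1 (adj _ _ _ mA lA)).
  have jS : j \in S by rewrite inE connect0.
  have := bc k; rewrite -(bc j) jS => /eqP.
  by case: (boolP (k \in S)) => [|_]; [rewrite inE | rewrite eq_sym oner_eq0].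
have bE j k : connect (type_graph A) j k -> b j = b k.
  case/connectP=> p; elim: p j => [|l p IHp] j /=; first by move=> _ ->.
  case/andP=> /existsP[i /andP[jA lA]] lp /(IHp _ lp) <-.
  apply: (@addrI _ (a i)); rewrite (ab0 (i, j)) ?inE //=.
  by have := ab0 (i, l); rewrite inE /= => ->.
pose j0 := Ordinal d_gt0; have bj0 j : b j = b j0.
  by apply: bE; move/forallP: conA => /(_ j)/forallP.
exists (- b j0); split=> [i|j]; last by rewrite opprK.
have /set0Pn[j jA] := forallP tA i.
by apply/eqP; rewrite -addr_eq0 -(bj0 j) (ab0 (i, j)) // inE.
Qed.

(** * Walks in comparability graphs *)

(** Traversability in the comparability graph: an undirected edge of position
    [i] contributes both [(j, k)] and [(k, j)] here, as [j] and [k] both lie in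
    [A i] and in [B i]. *)
Definition cg_rel (A B : pretype n d) : rel 'I_d :=
  fun j k => [exists i, (j \in A i) && (k \in B i)].

Lemma cg_step_rel A B u e v : cg_step A B u e v -> cg_rel A B u v.
Proof.
case: e => [[i j] k] /= /andP[/andP[jA kB] /orP[/andP[/eqP-> /eqP->]|]].
  by apply/existsP; exists i; rewrite jA.
case/and3P=> /andP[/setIP[? jB] /setIP[kA ?]] /eqP-> /eqP->.
by apply/existsP; exists i; rewrite kA.
Qed.

Lemma cg_walk_connect A B a s b : cg_walk A B a s b -> connect (cg_rel A B) a b.
Proof.
elim: s a => [|[e w] s IHs] a /=; first by move/eqP->.
by case/andP=> /cg_step_rel/connect1 aw /IHs; apply: connect_trans.
Qed.

(** The edges of a path, counted at their sources in [A] and at their targets in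
    [B], have equal row sums, and their column sums differ only at the ends. *)
Lemma path_weights A B j k : connect (cg_rel A B) j k ->
  exists w w', [/\ carried (type_face A) w, carried (type_face B) w' &
    forall a b, \sum_v w v * (a v.1 + b v.2) + b k =
                \sum_v w' v * (a v.1 + b v.2) + b j].
Proof.
case/connectP=> p; elim: p j => [|l p IHp] j /=.
  move=> _ ->; exists (fun=> 0), (fun=> 0); split=> [||a b] //.
move=> /andP[/existsP[i /andP[jA lB]] lp] kp.
have [w [w' [cw cw' E]]] := IHp l lp kp.
exists (fun v => w v + indic [set (i, j)] v), (fun v => w' v + indic [set (i, l)] v).
split=> [||a b].
- by apply/carriedD/carried_point => //; rewrite in_type_face.
- by apply/carriedD/carried_point => //; rewrite in_type_face.
under eq_bigr do rewrite mulrDl; under [in RHS]eq_bigr do rewrite mulrDl.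
rewrite !big_split /= !sum_indic1 /=; have := E a b; lra.
Qed.

(** * Coordinates carried by a triangulation *)

Section Triangulation.
Variable T : {set {set I}}.
Hypothesis T_tri : triangulation R T.

(** Two simplices meet in a common face, and a point of that face has the same
    barycentric coordinates in the face and in both simplices. Hence the weights
    representing a given point do not depend on the simplex they live on. Stated
    for the cone over the polytope, to avoid normalizing weights in every use. *)
Lemma carried_uniq F G w w' : F \in T -> G \in T ->
  carried F w -> carried G w' -> moment_eq w w' -> w =1 w'.
Proof.
move=> FT GT cw cw' E.
have s_ge0 : 0 <= \sum_v w v by apply: sumr_ge0 => v _; case: cw.
have [s0|s_neq0] := eqVneq (\sum_v w v) 0.
  have s0' : \sum_v w' v = 0 by rewrite -(moment_eq_total E).
  move=> v; rewrite (psumr_eq0P (fun u _ => cw.1 u) s0) //.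
  by rewrite (psumr_eq0P (fun u _ => cw'.1 u) s0').
set s := \sum_v w v in s_ge0 s_neq0; have si_ge0 : 0 <= s^-1 by rewrite invr_ge0.
(* Only weights of total 1 are convex combinations, so both are rescaled. *)
have cu := carried_scale si_ge0 cw; have cu' := carried_scale si_ge0 cw'.
have Eu := moment_eq_scale s^-1 E.
set u := fun v => s^-1 * w v in cu Eu; set u' := fun v => s^-1 * w' v in cu' Eu.
have u1 : \sum_v u v = 1 by rewrite -mulr_sumr mulVf.
have [H [HF HG FGH]] := tri_meet T_tri FT GT.
have : conv_hull pv H (\sum_v u v *: pv v).
  rewrite -FGH; split; first exact: carried_hull.
  rewrite (moment_eqP u u').1 //; apply: carried_hull => //.
  by rewrite -(moment_eq_total Eu).
case/hull_carried=> h [[_ h0] _ uh].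
have h_off (K : {set I}) v : H \subset K -> v \notin K -> h v = 0.
  by move=> HK vK; apply: h0; apply: contraNN vK; apply/subsetP.
have uh1 : u =1 h.
  apply: (affine_uniq (tri_simplex T_tri FT)).
  - by case: cu.
  - by move=> v; apply: h_off.
  - exact/moment_eqP.
have uh2 : u' =1 h.
  apply: (affine_uniq (tri_simplex T_tri GT)).
  - by case: cu'.
  - by move=> v; apply: h_off.
  - by apply/moment_eqP; rewrite -uh; apply/esym/moment_eqP.
move=> v; have si : s^-1 != 0 by rewrite invr_neq0.
by apply: (mulfI si); rewrite -[LHS]/(u v) -[RHS]/(u' v) uh1 uh2.
Qed.

(** The triangulation covers the product, hence its cone covers the cone. *)
Lemma carried_exists w : (forall v, 0 <= w v) -> \sum_v w v != 0 ->
  exists F w', [/\ F \in T, carried F w' & moment_eq w w'].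
Proof.
move=> w_ge0 s_neq0; set s := \sum_v w v in s_neq0.
have s_ge0 : 0 <= s by apply: sumr_ge0 => v _.
have si_ge0 : 0 <= s^-1 by rewrite invr_ge0.
have : @simplex_product R n d (\sum_v (s^-1 * w v) *: pv v).
  split; (split=> [i|]; last first).
  - have := sum_affine (fun=> 1) (fun=> 0) (erefl (\sum_v (s^-1 * w v) *: pv v)).
    rewrite [X in _ = _ + X]big1 ?addr0 => [|j _]; last by rewrite mulr0.
    under eq_bigr do rewrite /= mulr1.
    by under [RHS]eq_bigr do rewrite mulr1; rewrite -mulr_sumr mulVf.
  - by rewrite sum_vertex1 sumr_ge0 // => v _; rewrite addr0 !mulr_ge0.
  - have := sum_affine (fun=> 0) (fun=> 1) (erefl (\sum_v (s^-1 * w v) *: pv v)).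
    rewrite [X in _ = X + _]big1 ?add0r => [|j _]; last by rewrite mulr0.
    under eq_bigr do rewrite /= mulr1.
    by under [RHS]eq_bigr do rewrite mulr1; rewrite -mulr_sumr mulVf.
  - by rewrite sum_vertex2 sumr_ge0 // => v _; rewrite add0r !mulr_ge0.
rewrite -(tri_cover T_tri) => -[F /= FT /hull_carried[u [cu _ E]]].
exists F, (fun v => s * u v); split=> //; first exact: carried_scale.
move=> a b; have := moment_eq_scale s ((moment_eqP _ _).2 E) a b => <-.
by apply: eq_bigr => v _; rewrite mulrA mulfV ?mul1r.
Qed.

Definition ray w y (e : R) : I -> R := fun v => w v + e * y v.

Lemma sum_ray w y e f :
  \sum_v ray w y e v * f v = \sum_v w v * f v + e * \sum_v y v * f v.
Proof.
rewrite mulr_sumr -big_split /=; apply: eq_bigr => v _.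
by rewrite /ray mulrDl mulrA.
Qed.

(** A closedness statement proved without topology: the coordinates of
    [w + e y] in a fixed simplex are affine in [e], so if they are nonnegative
    for arbitrarily small [e > 0], they are nonnegative at [e = 0]. *)
Lemma ray_limit F w y : affinely_independent pv F ->
  (forall e, 0 < e -> exists e' u,
    [/\ 0 < e', e' < e, carried F u & moment_eq (ray w y e') u]) ->
  exists2 u, carried F u & moment_eq w u.
Proof.
move=> Find small; have [e1 [u1 [e1_gt0 _ [_ u10] E1]]] := small 1 ltr01.
have [e2 [u2 [e2_gt0 e21 [_ u20] E2]]] := small _ e1_gt0.
have e12 : e1 - e2 != 0 by rewrite subr_eq0 gt_eqF.
(* The affine function alpha + e beta of e that interpolates u1 and u2. *)
pose beta v := (u1 v - u2 v) / (e1 - e2).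
pose alpha v := u2 v - e2 * beta v.
have beta0 v : v \notin F -> beta v = 0.
  by move=> vF; rewrite /beta u10 ?u20 // subrr mul0r.
have alpha0 v : v \notin F -> alpha v = 0.
  by move=> vF; rewrite /alpha u20 ?beta0 // mulr0 subrr.
have Ebeta : moment_eq y beta.
  move=> a b; have := E1 a b; have := E2 a b; rewrite !sum_ray => H2 H1.
  have -> : \sum_v beta v * (a v.1 + b v.2) =
     (\sum_v u1 v * (a v.1 + b v.2) - \sum_v u2 v * (a v.1 + b v.2)) / (e1 - e2).
    rewrite -sumrB mulr_suml; apply: eq_bigr => v _.
    by rewrite /beta -mulrBl mulrAC.
  by rewrite -H1 -H2 opprD addrACA subrr add0r -mulrBl mulrAC mulfV ?mul1r.
have Ealpha : moment_eq w alpha.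
  move=> a b; have := E2 a b; rewrite sum_ray Ebeta => H2.
  have -> : \sum_v alpha v * (a v.1 + b v.2) =
     \sum_v u2 v * (a v.1 + b v.2) - e2 * \sum_v beta v * (a v.1 + b v.2).
    by rewrite mulr_sumr -sumrB; apply: eq_bigr => v _; rewrite /alpha mulrBl -mulrA.
  by rewrite -H2 addrK.
exists alpha => //; split=> // v; rewrite leNgt; apply/negP => av_lt0.
(* Below this e the coordinate alpha v + e beta v is still negative. *)
have b_gt0 : 0 < `|beta v| + 1 by rewrite ltr_wpDl.
have [|e [u [e_gt0 e_lt [u_ge0 u0] E]]] := small (- alpha v / (`|beta v| + 1)).
  by rewrite divr_gt0 // oppr_gt0.
have uE : u =1 ray alpha beta e.
  apply: (affine_uniq Find) => // [x xF|a b].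
    by rewrite /ray alpha0 // beta0 // mulr0 addr0.
  by rewrite -E !sum_ray Ealpha Ebeta.
have := u_ge0 v; rewrite uE /ray leNgt => /negP; apply.
move: e_lt; rewrite ltr_pdivlMr // mulrDr mulr1 => e_lt.
have : e * beta v <= e * `|beta v| by rewrite ler_pM2l // ler_norm.
lra.
Qed.

(** The star of [A] is a neighbourhood of the barycenter of [A] in the cone. As
    there are finitely many simplices, one of them, [F], contains points of the
    ray arbitrarily close to its origin; by [ray_limit] it contains the origin
    too, and the unique coordinates of the origin are positive on all of [A]. *)
Lemma star_cover A y : A \in T -> (forall v, 0 <= y v) ->
  exists F e u, [/\ F \in T, A \subset F, 0 < e, carried F u &
    moment_eq (ray (indic A) y e) u].
Proof.
move=> AT y_ge0; apply: contrapT => nostar.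
pose reach F e := exists2 u, carried F u & moment_eq (ray (indic A) y e) u.
have avoid F : F \in T -> exists2 e, 0 < e & forall e', 0 < e' < e -> ~ reach F e'.
  move=> FT; apply: contrapT => noe.
  have small e : 0 < e -> exists e' u,
      [/\ 0 < e', e' < e, carried F u & moment_eq (ray (indic A) y e') u].
    move=> e_gt0; apply: contrapT => nou; apply: noe; exists e => //.
    move=> e' /andP[? ?] [u cu Eu].
    by apply: nou; exists e', u.
  have [u cu Eu] := ray_limit (tri_simplex T_tri FT) small.
  have [e' [w [e'_gt0 _ cw Ew]]] := small 1 ltr01.
  apply: nostar; exists F, e', w; split=> //; apply/subsetP => v vA.
  apply/negPn/negP => vF; have := carried_uniq AT FT (carried_indic A) cu Eu v.
  by rewrite cu.2 // /indic vA => /eqP; rewrite oner_eq0.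
have [e e_gt0 avoid_e] : exists2 e, 0 < e & forall F, F \in T -> ~ reach F e.
  suff [e e_gt0 He] : exists2 e, 0 < e &
      forall F, F \in enum T -> forall e', 0 < e' < e -> ~ reach F e'.
    exists (e / 2) => [|F FT]; first lra.
    by apply: (He F); rewrite ?mem_enum //; lra.
  have: {subset enum T <= T} by move=> F; rewrite mem_enum.
  elim: (enum T) => [|F s IHs] sT; first by exists 1.
  have [|e1 e1_gt0 H1] := IHs; first by move=> G Gs; rewrite sT // inE Gs orbT.
  have [|e2 e2_gt0 H2] := avoid F; first by rewrite sT // mem_head.
  exists (Num.min e1 e2) => [|G]; first by rewrite lt_min e1_gt0.
  rewrite inE => /predU1P[->|Gs] e' /andP[e'_gt0]; rewrite lt_min => /andP[l1 l2].
    by apply: H2; rewrite e'_gt0.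
  by apply: H1; rewrite ?e'_gt0.
have ray_ge0 v : 0 <= ray (indic A) y e v.
  by rewrite addr_ge0 ?mulr_ge0 ?(ltW e_gt0) // (carried_indic A).1.
have [|F [u [FT cu Eu]]] := carried_exists ray_ge0; last first.
  by apply: (avoid_e F FT); exists u.
have /set0Pn[v vA] := tri_nonempty T_tri AT.
rewrite gt_eqF // (bigD1 v) //= ltr_wpDr ?sumr_ge0 //.
by rewrite /ray /indic vA ltr_wpDr // mulr_ge0 // ltW.
Qed.

(** * Comparability and boundary *)

(** An edge with a return path is undirected: by [path_weights] the closed path
    expresses one point with weights on [A] and with weights on [B], and by
    [carried_uniq] these weights agree, so the edge has both its ends in both. *)
Lemma comparable_return A B i j k : type_face A \in T -> type_face B \in T ->
  j \in A i -> k \in B i -> connect (cg_rel A B) k j -> j \in B i /\ k \in A i.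
Proof.
move=> AT BT jA kB /path_weights[w [w' [cw cw' E]]].
have cu := carriedD cw (carried_point (v := (i, j)) (F := type_face A) _).
have cu' := carriedD cw' (carried_point (v := (i, k)) (F := type_face B) _).
move: cu cu'; rewrite !in_type_face => /(_ jA) cu /(_ kB) cu'.
have u_eq := carried_uniq AT BT cu cu' _.
have {u_eq} u_eq : (fun v => w v + indic [set (i, j)] v) =1
                   (fun v => w' v + indic [set (i, k)] v).
  apply: u_eq => a b; under eq_bigr do rewrite mulrDl.
  under [in RHS]eq_bigr do rewrite mulrDl.
  rewrite !big_split /= !sum_indic1 /=; have := E a b; lra.
split; apply/negPn/negP => nB.
  have := u_eq (i, j); rewrite (cu'.2 (i, j)) ?in_type_face // => /eqP.
  rewrite /indic inE eqxx gt_eqF // ltr_wpDl // cw.1 //.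
have := u_eq (i, k); rewrite (cu.2 (i, k)) ?in_type_face // => /esym/eqP.
by rewrite /indic inE eqxx gt_eqF // ltr_wpDl // cw'.1.
Qed.

Lemma comparability A B : type_face A \in T -> type_face B \in T ->
  cg_acyclic A B.
Proof.
move=> AT BT b [s [walk dir]].
(* Any directed edge of the closed walk has a return path, the rest of it. *)
suff cycle c : cg_walk A B c s b -> has (fun x => ~~ cg_undirected A B x.1) s ->
    connect (cg_rel A B) b c -> False by exact: cycle walk dir (connect0 _ b).
elim: s c {walk dir} => [|[e w] s IHs] c //=.
case/andP=> step walk; have wb := cg_walk_connect walk.
case/orP=> [dir|dir] bc; last first.
  by apply: IHs walk dir _; apply: connect_trans bc (connect1 (cg_step_rel step)).
case: e step dir {IHs} => [[i j] k] /= /andP[/andP[jA kB]].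
case/orP=> [/andP[/eqP cj /eqP wk] | /and3P[-> //]].
have [|jB kA] := comparable_return AT BT jA kB.
  by rewrite -cj -wk; apply: connect_trans bc.
by rewrite !inE jA kB jB kA.
Qed.

(** The face [Delta_{n-1} x {j}] is itself a simplex with no other vertices of
    the product, so the triangulation cannot subdivide it. *)
Lemma boundary_face j : (0 < n)%N -> type_face (@boundary_type n d j) \in T.
Proof.
move=> n_gt0; pose i0 := Ordinal n_gt0.
set S := type_face _; have inS v : (v \in S) = (v.2 == j).
  by rewrite inE ffunE inE.
(* The simplex carrying the sum of all (i, j): its weights are confined to
   column j, hence equal to 1 at each (i, j). *)
have [|F [u [FT cu E]]] := carried_exists (carried_indic S).1.
  rewrite gt_eqF // (bigD1 (i0, j)) //= ltr_pwDl //.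
    by rewrite /indic inS eqxx.
  by rewrite sumr_ge0 // => v _; rewrite ler0n.
have u0 v : v.2 != j -> u v = 0.
  move=> vj; pose b (k : 'I_d) : R := (k != j)%:R.
  have := E (fun=> 0) b; rewrite [LHS]big1 => [/esym s0|x _]; last first.
    by rewrite /indic inS /b add0r; case: eqP; rewrite ?mulr0 ?mul0r.
  have := psumr_eq0P _ s0; rewrite /b => /(_ _ v isT).
  rewrite vj add0r mulr1; apply => x _.
  by rewrite add0r mulr_ge0 ?ler0n // cu.1.
have iS : (i0, j) \in S by rewrite inS.
apply: (tri_face T_tri FT); first by apply/set0Pn; exists (i0, j).
apply/subsetP => -[i k]; rewrite inS /= => /eqP->.
apply/negPn/negP => /cu.2 uij; pose a (k : 'I_n) : R := (k == i)%:R.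
have := E a (fun=> 0); rewrite [RHS]big1 => [|[i' k'] _]; last first.
  have [k'j|k'j] := eqVneq k' j; last by rewrite u0 // mul0r.
  rewrite k'j /a /=; have [->|_] := eqVneq i' i; first by rewrite uij mul0r.
  by rewrite addr0 mulr0.
apply/eqP; rewrite gt_eqF // (bigD1 (i, j)) //= ltr_pwDl //.
  by rewrite /indic inS /a /= !eqxx addr0 mulr1.
rewrite sumr_ge0 // => v _; rewrite mulr_ge0 ?ler0n // /a addr0 ler0n //.
Qed.

(** * Elimination *)

(** The heart of elimination. Leave [A] towards [B] and let [F] be the simplex
    of the star of [A] that is entered first. In the comparability graph of [F]
    and [B], consider a terminal strong component among the elements that can
    still reach a row [i] with [A i != B i]. For such a row met by the component,
    [B i] lies in the component unless it meets the settled elements beyond it;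
    the latter is excluded by an affine functional separating [F] from the
    direction of [B], and then [comparable_return] puts [B i] inside [F]. *)
Lemma exchange_row (A B : pretype n d) : is_type A ->
  type_face A \in T -> type_face B \in T -> A != B ->
  exists i F, [/\ A i != B i, F \in T, type_face A \subset F &
    B i \subset face_type F i].
Proof.
move=> tA AT BT AB.
have [F [e [u [FT AF e_gt0 cu Eu]]]] := star_cover AT (carried_indic (type_face B)).1.
pose C := face_type F; have CT : type_face C \in T by rewrite face_typeK.
have AC i j : j \in A i -> j \in C i.
  by move=> jA; rewrite in_face_type (subsetP AF) // in_type_face.
(* The elements from which CG_{C,B} never leads to a row where A and B differ;
   this is the largest set closed under reachability that avoids such rows. *)
pose settled := [set j | [forall k, connect (cg_rel C B) j k ==>
  [forall i, (k \in C i) ==> (A i == B i)]]].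
have settledP j k i : j \in settled -> connect (cg_rel C B) j k -> k \in C i -> A i = B i.
  by rewrite inE => /forallP/(_ k)/implyP jP /jP /forallP/(_ i)/implyP iP /iP /eqP.
have settled_closed j k : j \in settled -> connect (cg_rel C B) j k -> k \in settled.
  rewrite !inE => /forallP jP jk; apply/forallP => l; apply/implyP => kl.
  exact: (implyP (jP l) (connect_trans jk kl)).
have step i j k : j \in C i -> k \in B i -> connect (cg_rel C B) j k.
  by move=> jC kB; apply: connect1; apply/existsP; exists i; rewrite jC.
have B_settled i : A i != B i -> [disjoint B i & settled].
  move=> ABi; apply/pred0Pn => -[k /andP[/= kB kU]].
  (* Otherwise the functional (a, b) vanishes on A, is nonpositive on F and is
     positive at B, so no point beyond A towards B lies in the cone over F. *)
  pose a (i : 'I_n) : R := - (A i :&: settled != set0)%:R.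
  pose b (j : 'I_d) : R := (j \in settled)%:R.
  have A0 : \sum_v indic (type_face A) v * (a v.1 + b v.2) = 0.
    apply: big1 => -[i' j] _; rewrite /indic in_type_face /a /b /=.
    have [jA|] := boolP (j \in A i'); last by rewrite mul0r.
    have [jU|jU] := boolP (j \in settled).
      suff -> : A i' :&: settled != set0 by rewrite addNr mulr0.
      by apply/set0Pn; exists j; rewrite inE jA.
    suff -> : A i' :&: settled == set0 by rewrite /= addr0 oppr0 mulr0.
    apply/set0Pn => -[l /setIP[lA lU]]; case/negP: jU.
    apply: (settled_closed _ _ lU); apply: (step i'); first exact: AC.
    by rewrite -(settledP l l i' lU (connect0 _ _) (AC _ _ lA)).
  have C_le0 : \sum_v u v * (a v.1 + b v.2) <= 0.
    rewrite -oppr_ge0 -sumrN sumr_ge0 // => -[i' j] _; rewrite oppr_ge0.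
    have [jC|jC] := boolP ((i', j) \in F); last by rewrite cu.2 // mul0r.
    apply: mulr_ge0_le0; first exact: cu.1.
    rewrite /a /b /=; have [jU|_] := boolP (j \in settled); last first.
      by rewrite addr0 oppr_le0 ler0n.
    rewrite -in_face_type -/C in jC.
    have ABi' : A i' = B i' by exact: settledP jU _ jC.
    suff -> : A i' :&: settled != set0 by rewrite addNr.
    have /set0Pn[l lA] := forallP tA i'; apply/set0Pn; exists l.
    by rewrite inE lA; apply: settled_closed jU _; apply: (step i') => //; rewrite -ABi'.
  have B_gt0 : 0 < \sum_v indic (type_face B) v * (a v.1 + b v.2).
    rewrite (bigD1 (i, k)) //= ltr_pwDl //.
      rewrite /indic in_type_face kB mul1r /a /b kU.
      suff -> : A i :&: settled == set0 by rewrite oppr0 add0r.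
      apply/set0Pn => -[l /setIP[lA lU]].
      by case/eqP: ABi; apply: settledP lU (connect0 _ _) (AC _ _ lA).
    rewrite sumr_ge0 // => -[i' j] _; rewrite /indic in_type_face /a /b /=.
    have [jB|] := boolP (j \in B i'); last by rewrite mul0r.
    rewrite mul1r; have [_|/set0Pn[l /setIP[lA lU]]] := eqVneq (A i' :&: settled) set0.
      by rewrite oppr0 add0r ler0n.
    suff -> : j \in settled by rewrite addNr.
    by apply: (settled_closed _ _ lU); apply: (step i') => //; exact: AC.
  have := Eu a b; rewrite sum_ray A0 add0r => Eb.
  by move: C_le0; rewrite -Eb leNgt pmulr_rgt0 // B_gt0.
have [i0 ABi0] : exists i, A i != B i.
  apply/existsP; apply: contraNT AB; rewrite negb_exists => /forallP AB.
  by apply/eqP/ffunP => i; apply/eqP/negPn.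
have /set0Pn[k0 k0A] := forallP tA i0.
have k0U : k0 \notin settled.
  by apply: contra ABi0 => k0U; apply/eqP/(settledP _ _ _ k0U (connect0 _ _))/AC.
(* Minimality of p makes all unsettled elements reachable from p mutually
   reachable: they form a strong component from which every exit is settled. *)
pose below j := [set k | connect (cg_rel C B) j k].
have [p pU p_min] := arg_minnP (P := fun j => j \notin settled) (fun j => #|below j|) k0U.
have back k : connect (cg_rel C B) p k -> k \notin settled -> connect (cg_rel C B) k p.
  move=> pk kU; suff /setP/(_ p) : below k = below p by rewrite !inE connect0.
  apply/eqP; rewrite eqEcard p_min // andbT; apply/subsetP => l.
  by rewrite !inE; exact: connect_trans.
have [k [i [pk kC ABi]]] :
    exists k i, [/\ connect (cg_rel C B) p k, k \in C i & A i != B i].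
  move: pU; rewrite /settled inE negb_forall => /existsP[k]; rewrite negb_imply.
  case/andP=> pk; rewrite negb_forall => /existsP[i].
  by rewrite negb_imply => /andP[]; exists k, i.
have kU : k \notin settled.
  by apply: contra ABi => kU; apply/eqP/(settledP _ _ _ kU (connect0 _ _)).
exists i, F; split=> //; apply/subsetP => l lB.
(* i is a row where A and B differ, so B i stays in the component of p. *)
have lU : l \notin settled by rewrite (disjointFr (B_settled i ABi)).
have kl := step i k l kC lB.
have lk := connect_trans (back l (connect_trans pk kl) lU) pk.
by have [] := comparable_return CT BT kC lB lk.
Qed.

(** A face whose type has an empty coordinate lies in a
    boundary face [Delta_I x Delta_{d-1}] of the product; the others are kept. *)
Definition tri_types : {set pretype n d} :=
  [set A | is_type A && (type_face A \in T)].

Lemma tri_typesP A : reflect (is_type A /\ type_face A \in T) (A \in tri_types).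
Proof. by rewrite inE; apply: andP. Qed.

Lemma subtype_tri_types F A : (0 < n)%N -> is_type A -> F \in T ->
  type_face A \subset F -> A \in tri_types.
Proof.
move=> n_gt0 tA FT AF; apply/tri_typesP; split=> //; apply: (tri_face T_tri FT) => //.
have /set0Pn[j jA] := forallP tA (Ordinal n_gt0).
by apply/set0Pn; exists (Ordinal n_gt0, j); rewrite in_type_face.
Qed.

(** By induction on the number of positions where [A] and [B] differ:
    [exchange_row] lets the rows of [A] be turned into those of [B] one at a
    time inside the triangulation. *)
Lemma elimination A B j : (0 < n)%N -> A \in tri_types -> B \in tri_types ->
  exists C, [/\ C \in tri_types, C j = A j :|: B j &
    forall k, [\/ C k = A k, C k = B k | C k = A k :|: B k]].
Proof.
move=> n_gt0; have [m] := ubnP #|[set i | A i != B i]|.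
elim: m A => // m IHm A ltm AM BM; have [->|AB] := eqVneq A B.
  by exists B; split=> // [|k]; [rewrite setUid | constructor 1].
have [[tA AT] [tB BT]] := (tri_typesP _ AM, tri_typesP _ BM).
have [i [F [ABi FT AF BF]]] := exchange_row tA AT BT AB.
have inF k l : l \in A k -> (k, l) \in F.
  by move=> lA; rewrite (subsetP AF) // in_type_face.
have inFi l : l \in B i -> (i, l) \in F by move/(subsetP BF); rewrite in_face_type.
(* If i is the prescribed position, A i :|: B i is already available in F;
   otherwise row i of A is replaced by that of B. *)
have [ji|ji] := eqVneq j i.
  exists [ffun k => if k == i then A k :|: B k else A k]; split.
  - apply: (subtype_tri_types n_gt0 _ FT).
      apply/forallP => k; have /set0Pn[l lA] := forallP tA k; apply/set0Pn.
      by exists l; rewrite ffunE; case: ifP; rewrite // inE lA.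
    apply/subsetP => -[k l]; rewrite in_type_face ffunE /=.
    have [->|_] := eqVneq k i; last exact: inF.
    by case/setUP; [exact: inF | exact: inFi].
  - by rewrite ffunE ji eqxx.
  - by move=> k; rewrite ffunE; case: ifP => _; [constructor 3 | constructor 1].
pose D : pretype n d := [ffun k => if k == i then B k else A k].
have DM : D \in tri_types.
  apply: (subtype_tri_types n_gt0 _ FT).
    apply/forallP => k; rewrite ffunE.
    by case: ifP => _; [exact: (forallP tB) | exact: (forallP tA)].
  apply/subsetP => -[k l]; rewrite in_type_face ffunE /=.
  by have [->|_] := eqVneq k i; [exact: inFi | exact: inF].
have [|C [CM Cj Ck]] := IHm D _ DM BM.
  rewrite -ltnS; apply: leq_trans ltm; rewrite ltnS; apply: proper_card.
  apply/properP; split; last first.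
    by exists i; rewrite !inE // ffunE eqxx eqxx.
  by apply/subsetP => k; rewrite !inE ffunE; case: ifP => // _; rewrite eqxx.
exists C; split=> //; first by rewrite Cj ffunE (negbTE ji).
move=> k; have := Ck k; rewrite ffunE; case: ifP => // _.
by rewrite setUid => -[] ->; constructor 2.
Qed.

(** * The tropical oriented matroid of a triangulation *)

Lemma last_block_meets (P : seq {set 'I_d}) (S : {set 'I_d}) :
  ordered_partition P -> S != set0 -> S :&: nth set0 P (last_block P S) != set0.
Proof.
move=> /andP[_ /and3P[/eqP covP _ _]] /set0Pn[x xS].
have : x \in cover [set S in P] by rewrite covP.
case/bigcupP=> Q; rewrite inE => QP xQ.
have iP : (index Q P < size P)%N by rewrite index_mem.
pose meets := [pred m : 'I_(size P) | S :&: nth set0 P m != set0].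
have [|m mP max_m] := @eq_bigmax_cond _ meets (@nat_of_ord _).
  apply/card_gt0P; exists (Ordinal iP); rewrite inE /= nth_index //.
  by apply/set0Pn; exists x; rewrite inE xS.
have -> : last_block P S = m by exact: max_m.
by [].
Qed.

Lemma surrounding A P : (0 < n)%N -> A \in tri_types -> ordered_partition P ->
  refinement A P \in tri_types.
Proof.
move=> n_gt0 /tri_typesP[tA AT] ordP; apply: (subtype_tri_types n_gt0 _ AT).
  by apply/forallP => i; rewrite ffunE last_block_meets // (forallP tA).
by apply/subsetP => v; rewrite !in_type_face ffunE => /setIP[].
Qed.

Lemma tri_types_tom : (0 < n)%N -> tropical_oriented_matroid tri_types.
Proof.
move=> n_gt0; split.
- by move=> A /tri_typesP[].
- move=> j; apply/tri_typesP; split; last exact: boundary_face.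
  by apply/forallP => i; rewrite ffunE; apply/set0Pn; exists j; rewrite inE.
- by move=> A B j; apply: elimination.
- by move=> A B /tri_typesP[_ AT] /tri_typesP[_ BT]; apply: comparability.
- by move=> A P; apply: surrounding.
Qed.

(** Both sides consist of the types of the faces whose bipartite graph is a
    spanning tree of [K_{n,d}]: connectivity gives the left side, the number [n + d - 1] of edges
    the right side. *)
Lemma tri_types_vertices : (0 < n)%N -> (0 < d)%N ->
  tom_vertices tri_types = [set face_type F | F in full_simplices T].
Proof.
move=> n_gt0 d_gt0.
have full F : F \in T -> (simplex_dim F == n + d - 2)%N =
    is_type (face_type F) && type_graph_connected (face_type F).
  move=> FT; have F_gt0 : (0 < #|F|)%N.
    by rewrite card_gt0 (tri_nonempty T_tri).
  have -> : (simplex_dim F == n + d - 2)%N = (#|F| == (n + d).-1).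
    by move: F_gt0; rewrite /simplex_dim; lia.
  have cardF := card_only_trivial n_gt0 (tri_simplex T_tri FT).
  have spanF := only_trivial_spanning (face_type F) d_gt0; rewrite face_typeK in spanF.
  by apply/idP/andP => [/cardF/spanF | /spanF/cardF].
apply/setP => A; rewrite !inE; apply/idP/imsetP => [/andP[/andP[tA AT] conA]|[F]].
  by exists (type_face A); rewrite ?type_faceK // inE AT full // type_faceK tA.
by rewrite inE => /andP[FT]; rewrite full // => /andP[tA conA] ->; rewrite face_typeK FT tA.
Qed.

End Triangulation.
End Weights.

Local Close Scope ring_scope.

Theorem theorem6p3 (R : realType) (n : nat) (n_ge1 : 1 <= n)
    (T : {set {set 'I_n * 'I_3}}) (T_tri : triangulation R T) :
  exists M : {set pretype n 3},
    tropical_oriented_matroid M /\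
    tom_vertices M = [set face_type F | F in full_simplices T].
Proof.
exists (tri_types T); split; first exact: tri_types_tom T_tri n_ge1.
exact: tri_types_vertices T_tri n_ge1 isT.
Qed.
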